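(* Let $e=\{k_1,k_2\}$ be an edge of a connected finite simple graph $G$ with vertex set $\{0,1,\dots,n\}$, and let $G'$ be the contraction of $G$ along $e$. Then the cells of the edge contraction subdivision $\mathcal{D}_{k_1,k_2}$ of the adjacency polytope $\nabla_G$ are in one-to-one correspondence with the facets of the adjacency polytope $\nabla_{G'}$.
   Context: For a connected finite simple graph $G$ with vertex set $\{0,1,\dots,n\}$ and edge set $E(G)$, let $\mathbf{e}_1,\dots,\mathbf{e}_n$ be the standard basis of $\mathbb{R}^n$ and $\mathbf{e}_0=\mathbf{0}$. Put $A_G=\{\mathbf{e}_i-\mathbf{e}_j : \{i,j\}\in E(G)\}$ (both orientations of every edge are included). The adjacency polytope is $\nabla_G=\operatorname{conv}(A_G)\subset\mathbb{R}^n$. For a connected graph with another vertex set, relabel its $m+1$ vertices by $0,1,\dots,m$ (different relabelings give linearly isomorphic polytopes). Facets are proper faces of maximal dimension; if the graph has a single vertex then its adjacency polytope is $\{\mathbf{0}\}$ and by convention its only facet is $\varnothing$. Contraction: for an edge $e=\{a,b\}$ of a simple graph $H$, the contraction of $H$ along $e$ is the simple graph obtained by merging $a$ and $b$ into one vertex (removing the resulting loop and merging parallel edges). Edge contraction subdivision: for an edge $\{k_1,k_2\}\in E(G)$, let $\omega:A_G\to\mathbb{Z}$ be given by $\omega(\mathbf{e}_i-\mathbf{e}_j)=0$ if $\{i,j\}=\{k_1,k_2\}$ and $\omega(\mathbf{e}_i-\mathbf{e}_j)=1$ otherwise. $\mathcal{D}_{k_1,k_2}$ is the regular subdivision of $\nabla_G$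 (as a subdivision of the point configuration $A_G$) induced by $\omega$: its cells are the subsets $C\subseteq A_G$ with $\dim\operatorname{conv}(C)=n$ for which there exist $\boldsymbol\alpha\in\mathbb{R}^n$ and $h\in\mathbb{R}$ with $\langle\mathbf{x},\boldsymbol\alpha\rangle+\omega(\mathbf{x})=h$ for all $\mathbf{x}\in C$ and $\langle\mathbf{x},\boldsymbol\alpha\rangle+\omega(\mathbf{x})>h$ for all $\mathbf{x}\in A_G\setminus C$. *)

(* Defs.v *)
(* Libraries: Mathematical Components and MathComp-Analysis. *)
From HB Require Import structures.
From mathcomp Require Import all_boot all_order all_algebra.
From mathcomp Require Import boolp classical_sets functions reals convex.

Set Implicit Arguments.
Unset Strict Implicit.
Unset Printing Implicit Defensive.

Import Order.TTheory GRing.Theory Num.Theory.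

Local Open Scope classical_set_scope.
Local Open Scope ring_scope.

Record simple_graph (V : finType) := SimpleGraph {
  adj : rel V;
  adj_sym : symmetric adj;
  adj_irr : irreflexive adj
}.

Definition connected_graph (V : finType) (G : simple_graph V) : Prop :=
  forall x y : V, connect (adj G) x y.

Definition graph_isomorphism (V W : finType) (G : simple_graph V)
    (H : simple_graph W) (f : V -> W) : Prop :=
  bijective f /\ forall x y, adj H (f x) (f y) = adj G x y.

(* [None] is the vertex obtained by merging [a] and [b]; every other vertex [v]
   of [G] survives as [Some v]. *)
Definition contracted_vertex (V : finType) (a b : V) : finType :=
  option {v : V | (v != a) && (v != b)}.

Definition merge (V : finType) (a b : V) (v : V) : contracted_vertex a b :=
  insub v.

Definition contraction_adj (V : finType) (G : simple_graph V) (a b : V) :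
    rel (contracted_vertex a b) :=
  fun x y => (x != y) &&
    [exists u, exists v, [&& merge a b u == x, merge a b v == y & adj G u v]].

Lemma contraction_adj_sym (V : finType) (G : simple_graph V) (a b : V) :
  symmetric (@contraction_adj V G a b).
Proof.
suff H x y : contraction_adj G x y -> @contraction_adj V G a b y x.
  by move=> x y; apply/idP/idP; apply: H.
case/andP=> xy /existsP[u /existsP[v /and3P[ux vy uv]]].
rewrite /contraction_adj eq_sym xy; apply/existsP; exists v.
by apply/existsP; exists u; rewrite vy ux adj_sym.
Qed.

Lemma contraction_adj_irr (V : finType) (G : simple_graph V) (a b : V) :
  irreflexive (@contraction_adj V G a b).
Proof. by move=> x; rewrite /contraction_adj eqxx. Qed.

Definition contraction (V : finType) (G : simple_graph V) (a b : V) :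
    simple_graph (contracted_vertex a b) :=
  SimpleGraph (@contraction_adj_sym V G a b) (@contraction_adj_irr V G a b).

Section Polyhedral.
Context {R : realType} {n : nat}.
Implicit Types (A C P F : set 'rV[R]_n).

Definition dot (x y : 'rV[R]_n) : R := \sum_(i < n) x 0 i * y 0 i.

Definition conv_hull A : set 'rV[R]_n :=
  smallest (@convex_set R 'rV[R]_n) A.

Definition affinely_independent (k : nat) (p : 'I_k -> 'rV[R]_n) : Prop :=
  forall c : 'I_k -> R,
    \sum_i c i = 0 -> \sum_i c i *: p i = 0 -> forall i, c i = 0.

(* One less than the largest number of affinely independent points of [A]. Such
   a family in dimension n has at most n + 1 members, so the bound on [k] loses
   nothing; k = 0 is always admissible, and the empty set has dimension -1. *)
Definition affine_dim A : int :=
  (\max_(k < n.+2 | `[< exists p : 'I_k -> 'rV[R]_n,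
       affinely_independent p /\ forall i, A (p i) >]) k)%N%:Z - 1.

(* Both [P] (c = 0, h = 0) and the empty set (c = 0, h = 1) are faces of [P]. *)
Definition is_face P F : Prop :=
  exists (c : 'rV[R]_n) (h : R),
    (forall x, P x -> dot c x <= h) /\ F = P `&` [set x | dot c x = h].

Definition facets P : set (set 'rV[R]_n) :=
  [set F | [/\ is_face P F, F <> P &
     forall F', is_face P F' -> F' <> P -> affine_dim F' <= affine_dim F]].

Definition regular_subdivision A (w : 'rV[R]_n -> int) :
    set (set 'rV[R]_n) :=
  [set C | [/\ C `<=` A, affine_dim (conv_hull C) = n%:Z &
     exists (alpha : 'rV[R]_n) (h : R),
       (forall x, C x -> dot x alpha + (w x)%:~R = h) /\
       (forall x, (A `\` C) x -> dot x alpha + (w x)%:~R > h)]].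

End Polyhedral.

(* The vector e_i : the origin for i = 0, and otherwise the standard basis
   vector e_i of R^n, whose coordinates are indexed from 0 here. *)
Definition vertex_vec (R : realType) (n : nat) (i : 'I_n.+1) : 'rV[R]_n :=
  if unlift ord0 i is Some j then delta_mx 0 j else 0.
Arguments vertex_vec R {n} i.

Definition adjacency_vectors (R : realType) (n : nat)
    (G : simple_graph 'I_n.+1) : set 'rV[R]_n :=
  [set x | exists i j, adj G i j /\ x = vertex_vec R i - vertex_vec R j].
Arguments adjacency_vectors R {n} G _.

(* A graph with a single vertex has no edges; its polytope is the origin by
   convention, not the hull of the empty set. *)
Definition adjacency_polytope (R : realType) (n : nat)
    (G : simple_graph 'I_n.+1) : set 'rV[R]_n :=
  if n == 0%N then [set 0] else conv_hull (adjacency_vectors R G).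
Arguments adjacency_polytope R {n} G _.

(* The differences e_i - e_j with i <> j are pairwise distinct, so testing the
   vector amounts to testing {i, j} = {k1, k2}. *)
Definition contraction_weight (R : realType) (n : nat) (k1 k2 : 'I_n.+1)
    (x : 'rV[R]_n) : int :=
  if (x == vertex_vec R k1 - vertex_vec R k2)
     || (x == vertex_vec R k2 - vertex_vec R k1) then 0 else 1.

Definition edge_contraction_subdivision (R : realType) (n : nat)
    (G : simple_graph 'I_n.+1) (k1 k2 : 'I_n.+1) : set (set 'rV[R]_n) :=
  regular_subdivision (adjacency_vectors R G) (contraction_weight k1 k2).
Arguments edge_contraction_subdivision R {n} G k1 k2 _.

(* The convention that the empty set is the only facet in the one-vertex case
   is a consequence of the definitions above. *)
Lemma facets_one_vertex (R : realType) (G : simple_graph 'I_1) :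
  facets (adjacency_polytope R G) = [set set0].
Proof.
rewrite /adjacency_polytope eqxx.
have face0 : is_face [set (0 : 'rV[R]_0)] set0.
  exists 0, 1; split=> [x _|]; first by rewrite /dot big_ord0 ler01.
  apply/seteqP; split=> // x [_ /=]; rewrite /dot big_ord0 => /eqP.
  by rewrite eq_sym oner_eq0.
have sub0 (F : set 'rV[R]_0) :
    is_face [set (0 : 'rV[R]_0)] F -> F <> [set 0] -> F = set0.
  case=> c [h [_ ->]] neq; apply/seteqP; split=> // x [x0 xh].
  apply: neq; apply/seteqP; split=> [y []//|y y0]; split=> //.
  by rewrite y0 -x0.
apply/seteqP; split=> [F [+ + _]|F ->]; first exact: sub0.
split=> //; first by move/seteqP=> [_ /(_ 0 erefl)].
by move=> F' fF' nF'; rewrite (sub0 _ fF' nF').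
Qed.

(* Main.v *)
Require Import Defs.
From mathcomp Require Import all_boot all_order all_algebra.
From mathcomp Require Import boolp classical_sets functions reals.
From mathcomp Require Import cardinality convex interval_inference ring lra zify.

(**
Both families are parametrized by the same functions on vertices, so the
bijection is read off without comparing cells and facets directly.

A linear functional on R^n is a potential g on the vertices {0, ..., n} with
g 0 = 0, and its value on e_u - e_v is g u - g v. Call g rigid if g u - g v <= 1
along every edge and the tight edges, those with g u - g v = 1, connect the
graph. Connectedness is expressed linearly: a function that is constant along
tight edges is constant.

Facets. The polytope is centrally symmetric, so a nonempty proper face
lies on a hyperplane g = 1 that bounds the polytope, and it spans this
hyperplane exactly when the tight edges of g connect the graph. Thus the facets of a
connected graph are the faces g = 1 for g rigid (facetsE). As facets are the
proper faces of largest dimension, this needs one rigid potential to exist; the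
distance to a fixed vertex is one (rigid_potential_exists).

Cells. Write e for e_k1 - e_k2, and let (alpha, h) support a cell C. Testing on
e and -e gives h <= 0. If h were negative, C could not be full-dimensional
(cell_normal). Indeed C must contain e or -e, since otherwise it lies on the
hyperplane alpha = h - 1. All other edges in C change alpha by exactly h - 1, so
the fractional part of alpha / (h - 1) is constant along them; by fullness it
has to be constant on all vertices, and this forces h / (h - 1), a number
strictly between 0 and 1, to be an integer. Hence h = 0 and
alpha k1 = alpha k2, so -alpha is a potential that does not separate k1 from k2,
and full-dimensionality of C says that its tight edges together with {k1, k2}
connect the graph (cellsE).

Potentials on the graph that agree at k1 and k2 are the potentials on the
contraction, and rigidity is preserved (rigid_potential_pullback). In both
families the potential can be recovered from its tight edges
(rigid_vectors_inj), so the parametrizations are injective.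
*)

Set Implicit Arguments.
Unset Strict Implicit.
Unset Printing Implicit Defensive.

Import Order.TTheory GRing.Theory Num.Theory.

Local Open Scope classical_set_scope.
Local Open Scope ring_scope.

(** * Affine dimension and hyperplanes *)

Section Polyhedra.
Context {R : realType} {n : nat}.
Implicit Types (A C : set 'rV[R]_n) (x y c d : 'rV[R]_n) (t h : R).

Lemma dotC x y : dot x y = dot y x.
Proof. by apply: eq_bigr => i _; rewrite mulrC. Qed.

Lemma dotDl x y d : dot (x + y) d = dot x d + dot y d.
Proof. by rewrite /dot -big_split; apply: eq_bigr => i _; rewrite mxE mulrDl. Qed.

Lemma dotZl t x d : dot (t *: x) d = t * dot x d.
Proof. by rewrite /dot mulr_sumr; apply: eq_bigr => i _; rewrite mxE mulrA. Qed.

Lemma dotNl x d : dot (- x) d = - dot x d.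
Proof. by rewrite -scaleN1r dotZl mulN1r. Qed.

Lemma dot0l d : dot 0 d = 0.
Proof. by rewrite /dot big1 // => i _; rewrite mxE mul0r. Qed.

Lemma dotDr x c d : dot x (c + d) = dot x c + dot x d.
Proof. by rewrite dotC dotDl !(dotC _ x). Qed.

Lemma dotZr t x d : dot x (t *: d) = t * dot x d.
Proof. by rewrite dotC dotZl dotC. Qed.

Lemma dotNr x d : dot x (- d) = - dot x d.
Proof. by rewrite dotC dotNl dotC. Qed.

Lemma dot0r x : dot x 0 = 0.
Proof. by rewrite dotC dot0l. Qed.

Lemma sub_conv_hull A : A `<=` conv_hull A.
Proof. exact: sub_gen_smallest. Qed.

(** An open half-space together with a convex subset of its boundary hyperplane
    is convex. Taking [c] or [d] to be zero gives half-spaces and hyperplanes; in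
    general, equations satisfied by the generators on a supporting hyperplane are
    satisfied by the whole face that it cuts out. *)
Lemma conv_hull_sub_wedge A c h d t :
  (forall x, A x -> dot x c <= h /\ (dot x c = h -> dot x d = t)) ->
  forall x, conv_hull A x -> dot x c <= h /\ (dot x c = h -> dot x d = t).
Proof.
move=> AQ; apply: smallest_sub => //=.
apply/convex_setW => x y; rewrite !inE => -[xc xd] [yc yd] k k0 k1.
have convE v : dot (conv k x y) v = k%:num * dot x v + (1 - k%:num) * dot y v.
  by rewrite -!dotZl -dotDl.
apply: mem_set => /=; rewrite !convE.
set s := k%:num in k0 k1 *.
split=> [|e]; first by nra.
have [xh yh] : dot x c = h /\ dot y c = h by split; nra.
by rewrite xd // yd //; ring.
Qed.

Lemma conv_hull_dot_le A c h :
  (forall x, A x -> dot x c <= h) -> forall x, conv_hull A x -> dot x c <= h.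
Proof.
move=> AQ x Ax; suff [] : dot x c <= h /\ (dot x c = h -> dot x 0 = 0) by [].
by apply: conv_hull_sub_wedge Ax => y /AQ; split=> // _; rewrite dot0r.
Qed.

Lemma conv_hull_dot_eq A d t :
  (forall x, A x -> dot x d = t) -> forall x, conv_hull A x -> dot x d = t.
Proof.
move=> AQ x Ax.
suff [_] : dot x 0 <= 0 /\ (dot x 0 = 0 -> dot x d = t) by apply; rewrite dot0r.
by apply: conv_hull_sub_wedge Ax => y /AQ; rewrite dot0r.
Qed.

(** Lifting to height one turns affine independence into linear independence and
    affine functionals into linear ones. *)
Definition homogenize x : 'rV[R]_(n + 1) := row_mx x 1%:M.

Lemma homogenize_eval x d t :
  homogenize x *m (row_mx d t%:M)^T = (dot x d + t)%:M.
Proof.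
rewrite /homogenize tr_row_mx mul_row_col mul1mx tr_scalar_mx.
rewrite raddfD /=; congr (_ + _); apply/rowP => i.
by rewrite ord1 !mxE eqxx; apply: eq_bigr => j _; rewrite mxE.
Qed.

Lemma row_mx_scalar_eq0 d t :
  ((row_mx d t%:M : 'rV_(n + 1)) == 0) = (d == 0) && (t == 0).
Proof.
rewrite row_mx_eq0; congr andb.
apply/eqP/eqP => [/rowP /(_ 0)|->]; last by rewrite raddf0.
by rewrite !mxE eqxx.
Qed.

Lemma affinely_independentP (k : nat) (p : 'I_k -> 'rV[R]_n) :
  affinely_independent p <-> row_free (\matrix_i homogenize (p i)).
Proof.
set M := \matrix_i _.
have ME (u : 'rV_k) :
    u *m M = row_mx (\sum_i u 0 i *: p i) (\sum_i u 0 i)%:M.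
  apply/rowP => j; rewrite !mxE.
  case: splitP => l jl; rewrite ?ord1 ?mxE ?eqxx ?mulr1n ?summxE.
    have -> : j = lshift 1 l by exact: val_inj.
    by apply: eq_bigr => i _; rewrite [in LHS]mxE row_mxEl [in RHS]mxE.
  have -> : j = rshift n l by exact: val_inj.
  by apply: eq_bigr => i _; rewrite [in LHS]mxE row_mxEr mxE ord1 mulr1.
split=> [ind|/row_free_inj inj c c0 cp i].
  rewrite -kermx_eq0; apply/eqP/row_matrixP => i; rewrite row0.
  have : row i (kermx M) *m M = 0 by rewrite -row_mul mulmx_ker row0.
  rewrite ME => /eqP; rewrite row_mx_scalar_eq0 => /andP[/eqP e1 /eqP e2].
  apply/rowP => j; rewrite [RHS]mxE; apply: (ind (fun j => row i (kermx M) 0 j)) => //.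
have : (\row_j c j) *m M = 0 *m M.
  rewrite mul0mx ME (eq_bigr (fun i => c i *: p i)) => [|j _]; last by rewrite mxE.
  rewrite cp (eq_bigr c) => [|j _]; last by rewrite mxE.
  by rewrite c0 raddf0 row_mx0.
by move=> /inj /rowP /(_ i); rewrite !mxE.
Qed.

Lemma affine_dim_le A r (B : 'M[R]_(r, n + 1)) :
  (forall x, A x -> homogenize x *m B^T = 0) ->
  affine_dim A <= n%:Z - (\rank B)%:Z.
Proof.
move=> AB; rewrite /affine_dim.
suff H : (\max_(k < n.+2 | `[< exists p : 'I_k -> 'rV[R]_n,
    affinely_independent p /\ forall i, A (p i) >]) k <= n.+1 - \rank B)%N.
  have := rank_leq_col B; lia.
apply/bigmax_leqP => k /asboolP [p [/affinely_independentP]].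
set M := \matrix_i _ => Mfree pA.
have : (M <= kermx B^T)%MS.
  by apply/sub_kermxP/row_matrixP => i; rewrite row_mul rowK AB ?row0.
by move/mxrankS; rewrite mxrank_ker mxrank_tr (eqP Mfree); lia.
Qed.

(** Every point of [A] is in the affine span of a maximal affinely independent
    family of points of [A]; so the functionals vanishing on that family vanish
    on [A], and they form a space of dimension n - dim A. *)
Lemma affine_dim_ge A r (B : 'M[R]_(r, n + 1)) :
  (forall d t, (forall x, A x -> dot x d + t = 0) -> (row_mx d t%:M <= B)%MS) ->
  n%:Z - (\rank B)%:Z <= affine_dim A.
Proof.
move=> AB; rewrite /affine_dim.
set P := fun k : 'I_n.+2 => `[< exists p : 'I_k -> 'rV[R]_n,
    affinely_independent p /\ forall i, A (p i) >].
have P0 : P ord0.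
  by apply/asboolP; exists (fun=> 0); split=> [c _ _ []|[]].
rewrite (bigop.bigmax_eq_arg _ P0).
case: arg_maxnP => // k /asboolP [p [pind pA]] kmax.
have := pind => /affinely_independentP.
set M := \matrix_i _ => Mfree.
have spanM x : A x -> (homogenize x <= M)%MS.
  move=> Ax; apply: contraT => xM.
  have lt_k : (k < \rank (col_mx (homogenize x) M))%N.
    rewrite -addsmxE -[X in (X < _)%N](eqP Mfree); apply: rank_ltmx.
    by rewrite ltmxE addsmxSr addsmx_sub negb_and xM.
  have k1 : (1 + k < n.+2)%N.
    by have := rank_leq_col (col_mx (homogenize x) M); lia.
  pose q (i : 'I_(1 + k)) := if fintype.split i is inr j then p j else x.
  suff /kmax : P (Ordinal k1) by rewrite /= add1n ltnn.
  apply/asboolP; exists q; split; last by move=> i; rewrite /q; case: fintype.split.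
  apply/affinely_independentP.
  have -> : \matrix_i homogenize (q i) = col_mx (homogenize x) M.
    apply/row_matrixP => i; rewrite rowK /q -[i in RHS]splitK.
    case: fintype.split => j /=; first by rewrite rowKu ord1 row_id.
    by rewrite rowKd rowK.
  by rewrite /row_free eqn_leq rank_leq_row.
have : (kermx M^T <= B)%MS.
  apply/row_subP => i.
  have : row i (kermx M^T) *m M^T = 0 by rewrite -row_mul mulmx_ker row0.
  rewrite -[row i _]hsubmxK [rsubmx _]mx11_scalar.
  move: (lsubmx _) (rsubmx _ 0 0) => d t uM; apply: AB => x /spanM/submxP[w xw].
  have : homogenize x *m (row_mx d t%:M)^T = 0.
    by rewrite xw -mulmxA -[M]trmxK -trmx_mul uM trmx0 mulmx0.
  by rewrite homogenize_eval => /rowP /(_ 0); rewrite !mxE eqxx.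
move/mxrankS; rewrite mxrank_ker mxrank_tr (eqP Mfree); lia.
Qed.

(** A set is full-dimensional when no affine functional vanishes on it; convex
    hulls satisfy the same affine equations as their generators. *)
Lemma full_affine_dimP C :
  affine_dim (conv_hull C) = n%:Z <->
  forall d t, (forall x, C x -> dot x d + t = 0) -> d = 0 /\ t = 0.
Proof.
split=> [dimC d t dt0|H].
  have : affine_dim (conv_hull C) <= n%:Z - (\rank (row_mx d t%:M : 'rV_(n + 1)))%:Z.
    apply: affine_dim_le => x Cx; rewrite homogenize_eval.
    have -> : dot x d = - t.
      by apply: conv_hull_dot_eq Cx => y /dt0/eqP; rewrite addr_eq0 => /eqP.
    by rewrite addNr raddf0.
  rewrite dimC => le; have : \rank (row_mx d t%:M : 'rV_(n + 1)) = 0%N by lia.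
  by move/eqP; rewrite mxrank_eq0 row_mx_scalar_eq0 => /andP[/eqP -> /eqP ->].
apply/le_anti/andP; split.
  have := @affine_dim_le (conv_hull C) 0 0; rewrite mxrank0 subr0; apply.
  by move=> x _; apply/matrixP => ? [].
have := @affine_dim_ge (conv_hull C) 1 0; rewrite mxrank0 subr0; apply.
move=> d t H0; have [|-> ->] := H d t; first by move=> x /sub_conv_hull; apply: H0.
by rewrite raddf0 row_mx0 sub0mx.
Qed.

Lemma row_mx_scalar_sub c d t h :
  reflect (exists k, d = k *: c /\ t = k * h)
    (row_mx d t%:M <= (row_mx c h%:M : 'rV_(n + 1)))%MS.
Proof.
apply: (iffP sub_rVP) => -[k]; last first.
  by move=> [-> ->]; exists k; rewrite scale_row_mx scale_scalar_mx.
rewrite scale_row_mx scale_scalar_mx => /eq_row_mx [-> /rowP /(_ 0)].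
by rewrite !mxE eqxx; exists k.
Qed.

Lemma affine_dim_hyperplane A c h :
  (forall x, A x -> dot x c + h = 0) -> c != 0 \/ h != 0 ->
  affine_dim A <= n%:Z - 1.
Proof.
move=> Ach ch0; have rk : \rank (row_mx c h%:M : 'rV_(n + 1)) = 1%N.
  by rewrite rank_rV row_mx_scalar_eq0; case: ch0 => /negPf ->; rewrite ?andbF.
have := @affine_dim_le A 1 (row_mx c h%:M); rewrite rk; apply=> x /Ach.
by rewrite homogenize_eval => ->; rewrite raddf0.
Qed.

Lemma affine_dim_ge_hyperplane A c h :
  (forall d t, (forall x, A x -> dot x d + t = 0) ->
     exists k, d = k *: c /\ t = k * h) ->
  n%:Z - 1 <= affine_dim A.
Proof.
move=> H; have := @affine_dim_ge A 1 (row_mx c h%:M).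
have rk := rank_leq_row (row_mx c h%:M : 'rV_(n + 1)).
move=> le; apply: le_trans (le _); first lia.
by move=> d t /H /row_mx_scalar_sub.
Qed.

(** Two independent affine functionals vanishing on [A] would lower its dimension
    by two. *)
Lemma hyperplane_unique A c h d t :
  n%:Z - 1 <= affine_dim A -> c != 0 \/ h != 0 ->
  (forall x, A x -> dot x c + h = 0) -> (forall x, A x -> dot x d + t = 0) ->
  exists k, d = k *: c /\ t = k * h.
Proof.
move=> dimA ch0 Ac Ad; apply/row_mx_scalar_sub.
set u := row_mx c _; set v := row_mx d _.
have rk : \rank u = 1%N.
  by rewrite rank_rV row_mx_scalar_eq0; case: ch0 => /negPf ->; rewrite ?andbF.
have : affine_dim A <= n%:Z - (\rank (col_mx u v))%:Z.
  apply: affine_dim_le => x Ax; rewrite tr_col_mx mul_mx_row !homogenize_eval.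
  by rewrite Ac // Ad // raddf0 row_mx0.
rewrite -addsmxE => le.
have := mxrank_leqif_sup (addsmxSl u v); rewrite addsmx_sub submx_refl /= rk.
move=> [le1 <-]; apply/eqP; lia.
Qed.

End Polyhedra.

(** * Rigid potentials *)

Section Rigid.
Context {R : realType}.

(** The last clause says that the tight edges together with the edge {k1, k2}
    connect all vertices, in the form in which it is compared with the dimension
    of a face. Taking k1 = k2 gives the potentials of the graph itself, without
    any identification of vertices. *)
Definition rigid_potential (V : finType) (G : simple_graph V) (k1 k2 : V)
    (g : V -> R) : Prop :=
  [/\ g k1 = g k2,
      forall u v, adj G u v -> g u - g v <= 1 &
      forall f : V -> R, f k1 = f k2 ->
        (forall u v, adj G u v -> g u - g v = 1 -> f u = f v) ->
        forall u v, f u = f v].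

Lemma rigid_potential_shift (V : finType) (G : simple_graph V) (k1 k2 : V)
    (g g' : V -> R) (a : R) :
  (forall u, g' u = g u - a) ->
  rigid_potential G k1 k2 g -> rigid_potential G k1 k2 g'.
Proof.
move=> g'E [gk gle grig].
have diff u v : g' u - g' v = g u - g v by rewrite !g'E; ring.
split=> [|u v uv|f fk ft]; first by rewrite !g'E gk.
  by rewrite diff gle.
by apply: grig => // u v uv t; apply: ft; rewrite ?diff.
Qed.

(** The distance to [r] is rigid: it varies by at most one along an edge, and a
    shortest walk from [r] consists of tight edges. *)
Lemma rigid_potential_exists (V : finType) (G : simple_graph V) (r : V) :
  connected_graph G -> exists g : V -> R, rigid_potential G r r g.
Proof.
move=> Gconn.
pose walk v k := [exists p : k.-tuple V, path (adj G) r p && (last r p == v)].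
have walkP v k : reflect
    (exists p, [/\ path (adj G) r p, last r p = v & size p = k]) (walk v k).
  apply: (iffP existsP) => [[p /andP[rp /eqP pv]]|[p [rp pv pk]]].
    by exists p; rewrite size_tuple.
  by exists (tcast pk (in_tuple p)); rewrite val_tcast rp pv /=.
have walk_ex v : exists k, walk v k.
  by have /connectP[p rp pv] := Gconn r v; exists (size p); apply/walkP; exists p.
pose dist v := ex_minn (walk_ex v).
have distP v : walk v (dist v) by rewrite /dist; case: ex_minnP.
have dist_min v k : walk v k -> (dist v <= k)%N.
  by rewrite /dist; case: ex_minnP => d _; apply.
have dist_adj u v : adj G u v -> (dist v <= (dist u).+1)%N.
  move=> uv; have /walkP[p [rp pu <-]] := distP u.
  apply: dist_min; apply/walkP; exists (rcons p v).
  by rewrite rcons_path last_rcons size_rcons rp pu uv.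
have dist_pred v k : dist v = k.+1 -> exists2 u, adj G v u & dist u = k.
  move=> vk; have /walkP[p] := distP v; rewrite vk.
  case/lastP: p => [[]//|p w]; rewrite rcons_path last_rcons size_rcons.
  move=> [/andP[rp uw] wv [pk]]; exists (last r p); first by rewrite adj_sym -wv.
  have le : (dist (last r p) <= k)%N by apply: dist_min; apply/walkP; exists p.
  by move: uw => /dist_adj; rewrite wv vk; lia.
exists (fun v => (dist v)%:R); split=> // [u v|f _ ft].
  rewrite adj_sym => /dist_adj; rewrite -(ler_nat R) -natr1; lra.
suff const v : f v = f r by move=> u v; rewrite !const.
have [k] := ubnP (dist v); elim: k v => // k IH v vk.
case E: (dist v) vk => [|j] vk.
  by have := distP v; rewrite E => /walkP[p [_ <- /size0nil ->]].
have [u vu ju] := dist_pred _ _ E.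
rewrite (ft _ _ vu) ?E ?ju; last by rewrite -natr1; ring.
by apply: IH; rewrite ju.
Qed.

(** Here [psi] is the contraction map. A function on [V] that agrees at [k1] and
    [k2] factors through [psi]; the edges lost by the contraction carry
    difference zero, so the tight edges are the same on both sides. *)
Lemma rigid_potential_pullback (V W : finType) (G : simple_graph V)
    (G' : simple_graph W) (k1 k2 : V) (r : W) (psi : V -> W) (g : W -> R) :
  (forall x, exists u, psi u = x) ->
  psi k1 = psi k2 ->
  (forall u v, psi u = psi v -> u <> v ->
     (u = k1 /\ v = k2) \/ (u = k2 /\ v = k1)) ->
  (forall x y, adj G' x y <->
     x <> y /\ exists u v, [/\ psi u = x, psi v = y & adj G u v]) ->
  rigid_potential G' r r g <-> rigid_potential G k1 k2 (g \o psi).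
Proof.
move=> psi_surj psik psi_inj adjE; split=> -[gk gle grig].
  split=> [|u v uv|f fk ft] /=; first by rewrite psik.
    have [->|psi_uv] := pselect (psi u = psi v); first by rewrite subrr ler01.
    by apply: gle; apply/adjE; split=> //; exists u, v.
  have psif u v : psi u = psi v -> f u = f v.
    move=> uv; have [->//|ne] := pselect (u = v).
    by have [[-> ->]|[-> ->]] := psi_inj _ _ uv ne.
  have [s sK] := choice psi_surj.
  have fs u : f u = f (s (psi u)) by apply: psif; rewrite sK.
  move=> u v; rewrite fs [RHS]fs.
  apply: (grig (f \o s)) => // _ _ /adjE [_ [a [b [<- <- ab]]]] t /=.
  by rewrite -!fs; apply: ft.
split=> // [_ _ /adjE [_ [u [v [<- <- uv]]]]|f _ ft x y].
  exact: gle.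
have [u <-] := psi_surj x; have [v <-] := psi_surj y.
apply: (grig (f \o psi)) => [|a b ab t] /=; first by rewrite psik.
apply: ft => //; apply/adjE; split; last by exists a, b.
by move=> e; move: t; rewrite /= e subrr => /eqP; rewrite eq_sym oner_eq0.
Qed.

(** The functional [c] as a function on vertices; it vanishes at the vertex zero,
    which sits at the origin. *)
Definition potential (n : nat) (c : 'rV[R]_n) (i : 'I_n.+1) : R :=
  dot (vertex_vec R i) c.

(** Only functions vanishing at the vertex zero come from vectors; subtracting a
    constant changes no difference along an edge. *)
Definition vec_of (n : nat) (f : 'I_n.+1 -> R) : 'rV[R]_n :=
  \row_j (f (lift ord0 j) - f ord0).

Lemma dot_edge n (c : 'rV[R]_n) i j :
  dot (vertex_vec R i - vertex_vec R j) c = potential c i - potential c j.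
Proof. by rewrite dotDl dotNl. Qed.

Lemma potential0 n (c : 'rV[R]_n) : potential c ord0 = 0.
Proof. by rewrite /potential /vertex_vec unlift_none dot0l. Qed.

Lemma potential_lift n (c : 'rV[R]_n) j : potential c (lift ord0 j) = c 0 j.
Proof.
rewrite /potential /vertex_vec liftK /dot (bigD1 j) //= mxE !eqxx mul1r.
by rewrite big1 ?addr0 // => i /negPf ij; rewrite mxE ij andbF mul0r.
Qed.

Lemma potential_vec_of n (f : 'I_n.+1 -> R) i :
  potential (vec_of f) i = f i - f ord0.
Proof.
case: (unliftP ord0 i) => [j|] ->; first by rewrite potential_lift mxE.
by rewrite potential0 subrr.
Qed.

Lemma potential_inj n (c d : 'rV[R]_n) :
  (forall i, potential c i = potential d i) -> c = d.
Proof. by move=> cd; apply/rowP => j; rewrite -!potential_lift cd. Qed.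

Lemma vec_of_eq0 n (f : 'I_n.+1 -> R) : vec_of f = 0 -> forall i j, f i = f j.
Proof.
move=> f0; have const i : f i = f ord0.
  by apply/eqP; rewrite -subr_eq0 -potential_vec_of f0 /potential dot0r.
by move=> i j; rewrite !const.
Qed.

Definition rigid_vectors n (G : simple_graph 'I_n.+1) (k1 k2 : 'I_n.+1) :
    set 'rV[R]_n :=
  [set c | rigid_potential G k1 k2 (potential c)].

Lemma rigid_vec_of n (G : simple_graph 'I_n.+1) k1 k2 (f : 'I_n.+1 -> R) :
  rigid_potential G k1 k2 f -> rigid_vectors G k1 k2 (vec_of f).
Proof. exact: rigid_potential_shift (potential_vec_of f). Qed.

(** The difference of the two potentials is constant along the tight edges of the
    first, hence constant by rigidity, and both vanish at the vertex zero. *)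
Lemma rigid_vectors_inj n (G : simple_graph 'I_n.+1) k1 k2 (c d : 'rV[R]_n) :
  rigid_vectors G k1 k2 c -> rigid_vectors G k1 k2 d ->
  (forall u v, adj G u v ->
     potential c u - potential c v = 1 -> potential d u - potential d v = 1) ->
  c = d.
Proof.
move=> [ck _ crig] [dk _ _] cd; apply: potential_inj => i.
have := crig (fun u => potential c u - potential d u) _ _ i ord0.
rewrite /= !potential0 subrr => H; apply/eqP; rewrite -subr_eq0; apply/eqP/H.
  by rewrite ck dk.
by move=> u v uv t; have := cd _ _ uv t; lra.
Qed.

End Rigid.

(** * Cells of the subdivision *)

Section Cells.
Context {R : realType} {n : nat} (G : simple_graph 'I_n.+1) (k1 k2 : 'I_n.+1).

Local Notation A := (adjacency_vectors R G).
Local Notation w := (contraction_weight k1 k2).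
Local Notation e := (vertex_vec R k1 - vertex_vec R k2).

(** The part of the lower envelope on which the potential [c] attains the weight;
    the supporting functional of the subdivision is [- c], with value zero. *)
Definition cell_of (c : 'rV[R]_n) : set 'rV[R]_n :=
  A `&` [set x | dot x c = (w x)%:~R].

Lemma edge_in i j : adj G i j -> A (vertex_vec R i - vertex_vec R j).
Proof. by move=> ij; exists i, j. Qed.

Lemma weight_e : w e = 0.
Proof. by rewrite /contraction_weight eqxx. Qed.

Lemma weight_Ne : w (- e) = 0.
Proof. by rewrite /contraction_weight opprB eqxx orbT. Qed.

Lemma weightP (x : 'rV[R]_n) : (w x = 0 /\ (x = e \/ x = - e)) \/ w x = 1.
Proof.
rewrite /contraction_weight; case: ifP => [/orP H|]; [left|by right].
by split=> //; case: H => /eqP ->; rewrite ?opprB; auto.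
Qed.

Lemma weight_dot_ne (x c : 'rV[R]_n) :
  potential c k1 = potential c k2 -> dot x c != 0 -> w x = 1.
Proof.
move=> ck; case: (weightP x) => // -[_ xe].
by case: xe => ->; rewrite ?dotNl dot_edge ck subrr ?oppr0 eqxx.
Qed.

Lemma small_not_multiple (z : int) (s h : R) :
  h < 0 -> (s = h \/ s = - h) -> s = z%:~R * (h - 1) -> False.
Proof.
move=> h0 sh sz; have [z1|[z0|z1]] : 1 <= z \/ z = 0 \/ z <= -1 by lia.
- move: z1; rewrite -(ler_int R) => z1; nra.
- by move: sz; rewrite z0 mul0r; lra.
- move: z1; rewrite -(ler_int R) mulrN1z => z1; nra.
Qed.

(** Full-dimensionality forces the affine function supporting a cell to vanish at
    the origin and to agree at the two ends of the contracted edge, because a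
    nonzero [h] is incompatible with the integrality of the edge vectors. *)
Lemma cell_normal (C : set 'rV[R]_n) (alpha : 'rV[R]_n) (h : R) :
  adj G k1 k2 -> C `<=` A ->
  (forall d t, (forall x, C x -> dot x d + t = 0) -> d = 0 /\ t = 0) ->
  (forall x, C x -> dot x alpha + (w x)%:~R = h) ->
  (forall x, A x -> dot x alpha + (w x)%:~R >= h) ->
  h = 0 /\ potential alpha k1 = potential alpha k2.
Proof.
move=> k12 CA Cfull Ch Ah.
have Ae : A e by exact: edge_in.
have ANe : A (- e) by rewrite opprB; apply: edge_in; rewrite adj_sym.
set s := potential alpha k1 - potential alpha k2.
have se : dot e alpha = s by rewrite dot_edge.
have h_le0 : h <= 0.
  have := Ah _ Ae; have := Ah _ ANe.
  by rewrite weight_e weight_Ne dotNl se; lra.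
have sh : s = h \/ s = - h.
  have [[x [Cx [_ x0]]]|no] :=
    pselect (exists x, C x /\ w x = 0 /\ (x = e \/ x = - e)).
    case: x0 => xe; have := Ch _ Cx;
      rewrite xe ?weight_e ?weight_Ne ?dotNl se; lra.
  have [x Cx|_] := Cfull alpha (1 - h); last by lra.
  case: (weightP x) => [x0|x1]; first by case: no; exists x.
  by have := Ch _ Cx; rewrite x1; lra.
have [h0|h0] := eqVneq h 0.
  split=> //; apply/eqP; rewrite -subr_eq0 -/s.
  by case: sh => ->; rewrite h0 ?oppr0.
(* The remaining edges of the cell change [alpha] by [h - 1], so the fractional
   part of [alpha / (h - 1)] is constant along them. *)
exfalso; have hlt : h < 0 by rewrite lt_neqAle h0.
pose q u := potential alpha u / (h - 1).
pose f u := q u - (Num.floor (q u))%:~R.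
have h1 : h - 1 != 0 by lra.
have qshift i j : potential alpha i - potential alpha j = h - 1 -> f i = f j.
  move=> ij; have qi : q i = q j + 1.
    rewrite /q -(subrK (potential alpha j) (potential alpha i)) ij.
    by rewrite mulrDl divff // addrC.
  have floor_qi : Num.floor (q i) = Num.floor (q j) + 1.
    by rewrite qi floorDrz ?floor1.
  by rewrite /f floor_qi qi intrD; ring.
pose r := if s == h then f k1 - f k2 else f k2 - f k1.
(* On [C] both [f] and [alpha] take one value on the contracted edge and one on
   the others; [r] is the value of [f] on the orientation of the contracted edge
   on which [alpha] is [h], so this combination is constant on [C]. *)
have [x Cx|d0 r0] := Cfull (vec_of f - r *: alpha) (r * (h - 1)).
  rewrite dotDr dotNr dotZr.
  have := Ch _ Cx; have [i [j [ij xE]]] := CA _ Cx.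
  have xd : dot x (vec_of f) = f i - f j.
    by rewrite xE dot_edge !potential_vec_of; ring.
  case: (weightP x) => [[x0 xe]|x1].
    rewrite x0 addr0 => xh; rewrite xh.
    suff -> : dot x (vec_of f) = r by ring.
    move: xh; rewrite /r; case: eqP => [sh'|ne]; case: xe => -> ;
      rewrite ?dotNl ?se !dot_edge !potential_vec_of; lra.
  rewrite x1 => xh.
  have -> : dot x (vec_of f) = 0.
    by rewrite xd (qshift i j) ?subrr //; move: xh; rewrite xE dot_edge; lra.
  have -> : dot x alpha = h - 1 by lra.
  by ring.
have r00 : r = 0 by move/eqP: r0; rewrite mulf_eq0 (negPf h1) orbF => /eqP.
have fk : f k1 = f k2 by apply: vec_of_eq0; move: d0; rewrite r00 scale0r subr0.
(* Equal fractional parts at the two ends: s / (h - 1) is an integer. *)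
apply: (@small_not_multiple (Num.floor (q k1) - Num.floor (q k2)) s h) => //.
have -> : (Num.floor (q k1) - Num.floor (q k2))%:~R = q k1 - q k2.
  by rewrite intrB; move: fk; rewrite /f; lra.
by rewrite /q /s; field.
Qed.

(** A cell contains both orientations of the contracted edge, hence the origin in
    its affine span; so the affine equations it satisfies are functions constant
    along the tight edges and agreeing at [k1] and [k2]. *)
Lemma cellsE :
  adj G k1 k2 ->
  edge_contraction_subdivision R G k1 k2 = cell_of @` rigid_vectors G k1 k2.
Proof.
move=> k12; apply/seteqP; split=> [C|_ [c crig <-]].
  move=> [CA /full_affine_dimP Cfull [alpha [h [Ch Ah']]]].
  have Ah x : A x -> dot x alpha + (w x)%:~R >= h.
    move=> Ax; have [Cx|nCx] := pselect (C x); first by rewrite Ch.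
    by apply/ltW/Ah'.
  have [h0 alphak] := cell_normal k12 CA Cfull Ch Ah.
  have potN i : potential (- alpha) i = - potential alpha i by exact: dotNr.
  exists (- alpha).
    split=> [|u v uv|f fk ft]; first by rewrite !potN alphak.
      have := Ah _ (edge_in uv); rewrite dot_edge !potN h0.
      by case: (weightP (vertex_vec R u - vertex_vec R v)) => [[-> _]|->]; lra.
    apply: vec_of_eq0; suff [] : vec_of f = 0 /\ 0 = 0 :> R by [].
    apply: Cfull => x Cx; have [i [j [ij xE]]] := CA _ Cx; have := Ch _ Cx.
    rewrite addr0; case: (weightP x) => [[_ xe]|x1].
      move=> _; case: xe => ->; rewrite ?dotNl dot_edge !potential_vec_of;
        by rewrite fk subrr ?oppr0.
    rewrite x1 xE !dot_edge !potential_vec_of h0 => t.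
    by rewrite (ft _ _ ij) ?subrr // !potN; lra.
  apply/seteqP; split=> [x [Ax]|x Cx] /=.
    rewrite dotNr => xw; apply: contrapT => nCx.
    by have := Ah' x (conj Ax nCx); rewrite -xw h0; lra.
  by split; [exact: CA|have := Ch _ Cx; rewrite /= dotNr; lra].
have [ck cle cf] := crig.
split; first by move=> x [].
  apply/full_affine_dimP => d t dt.
  have de : cell_of c e.
    by split; [exact: edge_in|rewrite /= dot_edge weight_e ck subrr].
  have dNe : cell_of c (- e).
    split; first by rewrite opprB; apply: edge_in; rewrite adj_sym.
    by rewrite /= dotNl dot_edge weight_Ne ck subrr oppr0.
  have := dt _ de; have := dt _ dNe; rewrite dotNl dot_edge => t1 t2.
  have t0 : t = 0 by lra.
  split=> //; apply: potential_inj => i.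
  have -> : potential 0 i = potential d ord0.
    by rewrite potential0 /potential dot0r.
  apply: cf => [|u v uv tuv]; first by lra.
  have : cell_of c (vertex_vec R u - vertex_vec R v).
    split; first exact: edge_in.
    by rewrite /= (weight_dot_ne ck) dot_edge tuv // oner_eq0.
  by move=> /dt; rewrite dot_edge t0; lra.
exists (- c), 0; split=> [x [_ /= xc]|x [Ax nx]]; first by rewrite dotNr xc addNr.
have [i [j [ij xE]]] := Ax.
have le : dot x c <= (w x)%:~R.
  have [x0|x0] := eqVneq (dot x c) 0.
    by rewrite x0; case: (weightP x) => [[-> _]|->]; rewrite ?ler01.
  by rewrite (weight_dot_ne ck x0) xE dot_edge cle.
have ne : dot x c != (w x)%:~R by apply/eqP => E; apply: nx.
by rewrite dotNr addrC subr_gt0 lt_neqAle ne.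
Qed.

Lemma cell_of_inj : {in rigid_vectors G k1 k2 &, injective cell_of}.
Proof.
move=> c d; rewrite !inE => crig drig cd; apply: (rigid_vectors_inj crig drig).
move=> u v uv t; have [ck _ _] := crig; rewrite -dot_edge.
have w1 : w (vertex_vec R u - vertex_vec R v) = 1.
  by apply: (weight_dot_ne ck); rewrite dot_edge t oner_eq0.
have : cell_of c (vertex_vec R u - vertex_vec R v).
  by split; [exact: edge_in|rewrite /= w1 dot_edge].
by rewrite cd => -[_ /=]; rewrite w1.
Qed.

End Cells.

(** * Facets of the adjacency polytope *)

Section Facets.
Context {R : realType} {m : nat} (G : simple_graph 'I_m.+1).

Local Notation A := (adjacency_vectors R G).
Local Notation P := (adjacency_polytope R G).
Local Notation T := (rigid_vectors (R := R) G ord0 ord0).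

Definition face_of (c : 'rV[R]_m) : set 'rV[R]_m :=
  P `&` [set x | dot c x = 1].

Lemma edge_in_polytope i j : adj G i j -> P (vertex_vec R i - vertex_vec R j).
Proof.
move=> ij; rewrite /adjacency_polytope; case: ifP => [/eqP m0|_].
  by apply/rowP => -[k km]; exfalso; move: km; rewrite m0.
by apply: sub_conv_hull; exists i, j.
Qed.

Lemma polytope_rigid_le1 c x : T c -> P x -> dot c x <= 1.
Proof.
move=> [_ cle _]; rewrite /adjacency_polytope; case: ifP => _.
  by move=> ->; rewrite dot0r ler01.
rewrite dotC; move: x; apply: conv_hull_dot_le => x [i [j [ij ->]]].
by rewrite dot_edge cle.
Qed.

Lemma face_of_is_face c : T c -> is_face P (face_of c).
Proof. by move=> Tc; exists c, 1; split=> // x; apply: polytope_rigid_le1. Qed.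

(** Central symmetry: a point and its opposite cannot both lie on [c = 1]. If the
    graph has no edge at all, rigidity leaves it a single vertex, and the polytope
    is the origin. *)
Lemma face_of_neq c : T c -> face_of c <> P.
Proof.
move=> [_ _ crig] FP.
suff [x [Px PNx]] : exists x, P x /\ P (- x).
  move: Px PNx; rewrite -FP => -[_ /= x1] [_ /=].
  by rewrite dotNr x1; lra.
have [m0|m_gt0] := posnP m.
  by exists 0; move/eqP: m0 => m0; rewrite oppr0 /adjacency_polytope m0.
have [[u [v uv]]|no_edge] := pselect (exists u v, adj G u v).
  exists (vertex_vec R u - vertex_vec R v); rewrite opprB.
  by split; apply: edge_in_polytope; rewrite // adj_sym.
have := crig (fun u => (u == ord0)%:R) erefl _ ord0 ord_max.
rewrite eqxx -val_eqE /= (gtn_eqF m_gt0) => H.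
suff /eqP : 1 = 0 :> R by rewrite oner_eq0.
by apply: H => u v uv; case: no_edge; exists u, v.
Qed.

Lemma face_of_inj : {in T &, injective face_of}.
Proof.
move=> c d; rewrite !inE => crig drig cd; apply: (rigid_vectors_inj crig drig).
move=> u v uv t; rewrite -dot_edge.
have : face_of c (vertex_vec R u - vertex_vec R v).
  by split; [exact: edge_in_polytope|rewrite /= dotC dot_edge].
by rewrite cd => -[_ /=]; rewrite dotC.
Qed.

(** A functional that is constant on the tight edges is a multiple of [c] by
    rigidity, so the face lies on no other hyperplane. *)
Lemma face_of_dim c : T c -> m%:Z - 1 <= affine_dim (face_of c).
Proof.
move=> [_ _ crig]; apply: (@affine_dim_ge_hyperplane _ _ _ c (-1)) => d t dt.
have tight u v : adj G u v -> potential c u - potential c v = 1 ->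
    potential d u - potential d v = - t.
  move=> uv uv1; have := dt (vertex_vec R u - vertex_vec R v).
  rewrite dot_edge => H; apply/eqP; rewrite -addr_eq0; apply/eqP/H.
  by split; [exact: edge_in_polytope|rewrite /= dotC dot_edge].
exists (- t); split; last by ring.
apply: potential_inj => i.
have -> : potential (- t *: c) i = - t * potential c i by exact: dotZr.
have := crig (fun u => potential d u - - t * potential c u) _ _ i ord0.
rewrite /= !potential0 mulr0 subr0 => H; apply/eqP; rewrite -subr_eq0; apply/eqP/H => //.
by move=> u v uv uv1; have := tight _ _ uv uv1; nra.
Qed.

Lemma polytope_const c h : (forall x, A x -> dot c x = h) -> m != 0%N ->
  forall x, P x -> dot c x = h.
Proof.
move=> Ac /negPf m0 x; rewrite /adjacency_polytope m0 dotC; move: x.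
by apply: conv_hull_dot_eq => x /Ac; rewrite dotC.
Qed.

Lemma proper_face_dim F : m != 0%N -> is_face P F -> F <> P ->
  affine_dim F <= m%:Z - 1.
Proof.
move=> m0 [c [h [Pch FE]]] FP; apply: (@affine_dim_hyperplane _ _ _ c (- h)).
  by move=> x; rewrite FE dotC => -[_ /= ->]; rewrite subrr.
apply: contrapT => /not_orP [/negP c0 /negP h0]; apply: FP; rewrite FE.
move: c0 h0; rewrite !negbK oppr_eq0 => /eqP -> /eqP ->.
by apply/seteqP; split=> [x []//|x Px]; split=> //=; rewrite dot0l.
Qed.

(** By central symmetry a face supported at height [h <= 0] is the whole polytope,
    so the supporting functional can be scaled to height one. A function constant
    along the tight edges then gives a second hyperplane through the face; the
    dimension makes it proportional to the first, and it passes through the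
    origin, so it is zero. *)
Lemma large_face_rigid F : m != 0%N -> is_face P F -> F <> P ->
  m%:Z - 1 <= affine_dim F -> exists2 c, T c & face_of c = F.
Proof.
move=> m0 [b [h [Pbh FE]]] FP dimF.
have PE : P = conv_hull A by rewrite /adjacency_polytope (negPf m0).
have bh u v : adj G u v -> potential b u - potential b v <= h.
  by move=> uv; rewrite -dot_edge dotC; apply/Pbh/edge_in_polytope.
have h_gt0 : 0 < h.
  rewrite ltNge; apply/negP => h_le0; apply: FP; rewrite FE.
  apply/seteqP; split=> [x []//|x Px]; split=> //=; move: x Px.
  apply: polytope_const => // x [u [v [uv ->]]]; rewrite dotC dot_edge.
  by have := bh _ _ uv; rewrite adj_sym in uv; have := bh _ _ uv; lra.
have h0 : h != 0 by rewrite gt_eqF.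
pose c := h^-1 *: b.
have potc u : potential c u = h^-1 * potential b u by exact: dotZr.
have cb x : dot c x = 1 <-> dot b x = h.
  by rewrite dotZl; split=> [H|->]; rewrite ?mulVf // -(mulVKf h0 (dot b x)) H mulr1.
exists c; last first.
  by rewrite FE; apply/seteqP; split=> x [Px /cb].
have cle u v : adj G u v -> potential c u - potential c v <= 1.
  by move=> /bh le_h; rewrite !potc -mulrBr -(ler_pM2l h_gt0) mulVKf // mulr1.
split=> // f _ ft; apply: vec_of_eq0.
have Fc x : F x -> dot x c + (- 1) = 0.
  by rewrite FE => -[_ /= /cb]; rewrite dotC => ->; rewrite subrr.
have Ff x : F x -> dot x (vec_of f) + 0 = 0.
  move=> Fx; have := Fc _ Fx; rewrite addr0 => /eqP; rewrite subr_eq0 => /eqP xc.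
  have : conv_hull A x by rewrite -PE; move: Fx; rewrite FE => -[].
  move/(@conv_hull_sub_wedge _ _ A c 1 (vec_of f) 0) => H.
  have [|_] := H; last by apply.
  move=> _ [u [v [uv ->]]]; rewrite !dot_edge cle // !potential_vec_of.
  by split=> // /(ft _ _ uv) ->; ring.
have [|k [-> kh]] := hyperplane_unique dimF _ Fc Ff.
  by right; rewrite oppr_eq0 oner_eq0.
suff -> : k = 0 by rewrite scale0r.
by lra.
Qed.

Lemma rigid_vector_exists : connected_graph G -> exists c, T c.
Proof.
move=> Gconn.
have [g grig] := @rigid_potential_exists R _ _ ord0 Gconn.
by exists (vec_of g); apply: rigid_vec_of.
Qed.

(** One rigid potential gives a proper face of codimension one, so that the proper
    faces of largest dimension are those of codimension one. *)
Lemma facetsE_pos : connected_graph G -> m != 0%N -> facets P = face_of @` T.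
Proof.
move=> Gconn m0; have [c0 Tc0] := rigid_vector_exists Gconn.
apply/seteqP; split=> [F [Fface FP Fmax]|_ [c Tc <-]].
  have [|c Tc <-] := large_face_rigid m0 Fface FP; last by exists c.
  apply: le_trans (face_of_dim Tc0) _.
  by apply: Fmax (face_of_is_face Tc0) _; apply: face_of_neq.
split; [exact: face_of_is_face|exact: face_of_neq|].
by move=> F Fface FP; apply: le_trans (proper_face_dim m0 Fface FP) (face_of_dim Tc).
Qed.

End Facets.

Lemma facetsE (R : realType) (m : nat) (G : simple_graph 'I_m.+1) :
  connected_graph G ->
  facets (adjacency_polytope R G) = face_of G @` rigid_vectors G ord0 ord0.
Proof.
case: m G => [|m] G Gconn; last exact: facetsE_pos.
rewrite facets_one_vertex; have [c Tc] := rigid_vector_exists Gconn (R := R).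
have face0 d : face_of (R := R) G d = set0.
  by apply/seteqP; split=> // x [_ /= /eqP]; rewrite /dot big_ord0 eq_sym oner_eq0.
apply/seteqP; split=> [_ ->|_ [d _ <-]]; last exact: face0.
by exists c.
Qed.

(** * The correspondence *)

Theorem corollary2 (R : realType) (n : nat) (G : simple_graph 'I_n.+1)
    (k1 k2 : 'I_n.+1) (m : nat) (G' : simple_graph 'I_m.+1)
    (phi : contracted_vertex k1 k2 -> 'I_m.+1) :
  connected_graph G ->
  adj G k1 k2 ->
  graph_isomorphism (contraction G k1 k2) G' phi ->
  exists f : set 'rV[R]_n -> set 'rV[R]_m,
    set_bij (edge_contraction_subdivision R G k1 k2)
            (facets (adjacency_polytope R G')) f.
Proof.
move=> Gconn k12 [[phi' phiK phi'K] phiE].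
pose psi u := phi (Defs.merge k1 k2 u).
have psi_surj x : exists u, psi u = x.
  rewrite -(phi'K x); case: (phi' x) => [[v vP]|].
    by exists v; rewrite /psi /Defs.merge insubT.
  by exists k1; rewrite /psi /Defs.merge insubF // eqxx.
have psik : psi k1 = psi k2.
  by rewrite /psi /Defs.merge !insubF ?eqxx ?andbF.
have psi_inj u v : psi u = psi v -> u <> v ->
    (u = k1 /\ v = k2) \/ (u = k2 /\ v = k1).
  move/(can_inj phiK); rewrite /Defs.merge.
  case: insubP => [[a aP] _ /= <-|]; case: insubP => [[b bP] _ /= <-|] //.
    by move=> [->].
  rewrite !negb_and !negbK => /orP[] /eqP -> /orP[] /eqP -> _; tauto.
have adjE x y : adj G' x y <->
    x <> y /\ exists u v, [/\ psi u = x, psi v = y & adj G u v].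
  rewrite -(phi'K x) -(phi'K y) phiE; split.
    move=> /andP[ne /existsP[u /existsP[v /and3P[/eqP ux /eqP vy uv]]]].
    split; first by move/(can_inj phiK)/eqP; rewrite (negPf ne).
    by exists u, v; rewrite /psi ux vy.
  move=> [ne [u [v [/(can_inj phiK) ux /(can_inj phiK) vy uv]]]].
  apply/andP; split; first by apply/eqP => E; apply: ne; rewrite E.
  by apply/existsP; exists u; apply/existsP; exists v; rewrite ux vy !eqxx uv.
have G'conn : connected_graph G'.
  move=> x y; have [u <-] := psi_surj x; have [v <-] := psi_surj y.
  have /connectP[p up ->] := Gconn u v; elim: p u up => //= w p IH u /andP[uw wp].
  apply: connect_trans (IH _ wp).
  have [->|ne] := pselect (psi u = psi w); first exact: connect0.
  by apply/connect1/adjE; split=> //; exists u, w.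
rewrite (cellsE k12) facetsE //; apply/card_set_bijP.
have pullP g := @rigid_potential_pullback R _ _ G G' k1 k2 ord0 psi g
  psi_surj psik psi_inj adjE.
pose pull (c : 'rV[R]_m) : 'rV[R]_n := vec_of (potential c \o psi).
have pot_pull c u :
    potential (pull c) u = potential c (psi u) - potential c (psi ord0).
  by rewrite potential_vec_of.
have pull_inj : {in rigid_vectors (R := R) G' ord0 ord0 &, injective pull}.
  move=> c d _ _ cd; apply: potential_inj => x.
  have diff_const u : potential c (psi u) - potential d (psi u) =
      potential c (psi ord0) - potential d (psi ord0).
    by have := pot_pull c u; rewrite cd pot_pull; lra.
  have [u <-] := psi_surj x; have [z z0] := psi_surj ord0.
  by have := diff_const u; have := diff_const z; rewrite z0 !potential0; lra.
have pull_image :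
    pull @` rigid_vectors G' ord0 ord0 = rigid_vectors G k1 k2.
  apply/seteqP; split=> [_ [c /pullP crig <-]|c crig]; first exact: rigid_vec_of.
  have [s sK] := choice psi_surj.
  have sp u : potential c (s (psi u)) = potential c u.
    have [->//|ne] := pselect (s (psi u) = u).
    by have [ck _ _] := crig; have [[-> ->]|[-> ->]] := psi_inj _ _ (sK _) ne.
  exists (vec_of (potential c \o s)).
    apply: rigid_vec_of; apply/pullP.
    apply: (rigid_potential_shift (a := 0)) crig => u.
    by rewrite /= sp subr0.
  apply: potential_inj => u.
  by rewrite pot_pull !potential_vec_of /= !sp potential0; ring.
have cell_card :=
  inj_card_eq (cell_of_inj (R := R) (G := G) (k1 := k1) (k2 := k2)).
have face_card := inj_card_eq (face_of_inj (R := R) (G := G')).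
have pull_card := inj_card_eq pull_inj; rewrite pull_image in pull_card.
apply: (card_eq_trans cell_card); apply: (card_eq_trans pull_card).
by rewrite card_eq_sym.
Qed.
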